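(* Let $\mathbb{X},\mathbb{Y}$ be Asplund spaces, let $\psi:\mathbb{X}\rightarrow\mathbb{Y}$ be continuously differentiable, and let $g:\mathbb{Y}\rightarrow\mathbb{R}\cup\{+\infty\}$ be a proper lower semicontinuous convex function. Let $f:=g\circ\psi$, $\mathbf{S}_g:=\{y\in\mathbb{Y}:g(y)\leq 0\}$ and $\mathcal{S}:=\{x\in\mathbb{X}:(g\circ\psi)(x)\leq 0\}$. Assume that $\mathrm{bd}(\mathbf{S}_g)\subseteq g^{-1}(0)$ and that $\bar x\in\mathcal{S}$ is such that the derivative $\nabla\psi(\bar x)$ is surjective. Then the inequality $(g\circ\psi)(x)\leq 0$ has a local error bound at $\bar x$ if and only if the convex inequality $g(y)\leq 0$ has a local error bound at $\psi(\bar x)$.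
   Context: A Banach space $\mathbb{X}$ is an Asplund space if every continuous convex real-valued function on a nonempty open convex set $D\subseteq\mathbb{X}$ is Fréchet differentiable at each point of some dense $G_\delta$ subset of $D$. $\mathbb{B}(x,r)$ is the open ball with center $x$ and radius $r$, $\mathrm{bd}(\Omega)$ is the boundary of $\Omega$, and $\mathbf{d}(x,\Omega):=\inf\{\|x-u\|:u\in\Omega\}$. Local error bound: for an extended-real-valued function $h$ on a Banach space $\mathbb{Z}$ with $\mathbf{S}_h:=\{z\in\mathbb{Z}:h(z)\leq 0\}$, the inequality $h(z)\leq 0$ has a local error bound at $\bar z\in\mathbf{S}_h$ if there exist $\tau,\delta\in(0,+\infty)$ such that $\mathbf{d}(z,\mathbf{S}_h)\leq\tau h_+(z)$ for all $z\in\mathbb{B}(\bar z,\delta)$, where $h_+(z):=\max\{h(z),0\}$. This is applied with $h=g\circ\psi$ on $\mathbb{X}$ and with $h=g$ on $\mathbb{Y}$. *)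

(* Defs.v *)
From mathcomp Require Import all_boot all_order all_algebra.
From mathcomp Require Import all_classical all_reals all_analysis.
From mathcomp Require Import borel_hierarchy.

Set Implicit Arguments.
Unset Strict Implicit.
Unset Printing Implicit Defensive.

Import Order.TTheory GRing.Theory Num.Theory.
Import numFieldNormedType.Exports.

Local Open Scope classical_set_scope.
Local Open Scope ring_scope.

(* A real-valued function on D is represented by a total function X -> R^o:
   as D is open, its values outside D affect neither {within D, continuous f}
   nor differentiability at the points of D. For open D, the G_delta subsets of
   D (relative topology) are the G_delta subsets of X contained in D. *)
Definition asplund (R : realType) (X : completeNormedModType R) : Prop :=
  forall (D : set X) (f : X -> R^o),
    D !=set0 -> open D -> convex_set (D : set (convex_lmodType X)) ->
    {within D, continuous f} -> convex_function (E := X) D f ->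
    exists G : set X,
      [/\ G `<=` D, D `<=` closure G, Gdelta G &
          forall x, G x -> differentiable f x].

(* Valued in \bar R, hence +oo on unbounded maps. *)
Definition op_norm (R : realType) (X Y : normedModType R) (L : X -> Y)
    : \bar R :=
  ereal_sup [set `|L v|%:E | v in [set v | `|v| <= 1]].

Definition continuously_differentiable (R : realType) (X Y : normedModType R)
    (psi : X -> Y) : Prop :=
  (forall x, differentiable psi x) /\
  (forall x, op_norm (fun v => 'd psi y v - 'd psi x v) @[y --> x] --> 0%E).

Definition proper_fun (R : realType) (Y : Type) (g : Y -> \bar R) : Prop :=
  (forall y, g y != -oo%E) /\ (exists y, (g y < +oo)%E).

(* For g > -oo no indeterminate sum occurs; at t = 0, 1 the convention
   0 * +oo = 0 makes the inequality trivial. *)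
Definition ereal_convex (R : realType) (Y : lmodType R) (g : Y -> \bar R)
    : Prop :=
  forall (x y : Y) (t : R), 0 <= t <= 1 ->
    (g (t *: x + (1 - t) *: y)%R <= t%:E * g x + (1 - t)%:E * g y)%E.

Definition boundary (T : topologicalType) (A : set T) : set T :=
  closure A `\` interior A.

Definition distance (R : realType) (X : normedModType R) (x : X)
    (Omega : set X) : \bar R :=
  ereal_inf [set `|x - u|%:E | u in Omega].

Definition solution_set (R : realType) (Z : Type) (h : Z -> \bar R) : set Z :=
  [set z | (h z <= 0)%E].

Definition local_error_bound (R : realType) (Z : normedModType R)
    (h : Z -> \bar R) (zbar : Z) : Prop :=
  exists tau delta : R, [/\ 0 < tau, 0 < delta &
    forall z, ball zbar delta z ->
      (distance z (solution_set h) <= tau%:E * maxe (h z) 0)%E].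

(* Main.v *)
Require Import Defs.
From mathcomp Require Import all_boot all_order all_algebra.
From mathcomp Require Import all_classical all_reals all_analysis.
From mathcomp Require Import ring lra.

Set Implicit Arguments.
Unset Strict Implicit.
Unset Printing Implicit Defensive.

Import Order.TTheory GRing.Theory Num.Theory.
Import numFieldNormedType.Exports.

Local Open Scope classical_set_scope.
Local Open Scope ring_scope.

(** Near a point where its derivative is onto, a C^1 map between Banach spaces
    is metrically regular (Lyusternik and Graves): there is a constant kappa
    such that, for x near xbar and y near psi xbar, the equation psi v = y has
    a solution v with |x - v| <= kappa |y - psi x|.  The map is also Lipschitz
    near xbar, say with constant L.

    Write T for the solution set of g and S = psi^-1 T for that of g o psi.
    Solving psi v = u for points u of T close to psi x, and mapping points of S
    close to x forward by psi, gives the two comparisons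
      d(x, S) <= kappa d(psi x, T)   and   d(psi x, T) <= L d(x, S),
    valid for x near xbar; only nearby points of S and T matter, because xbar
    is in S and psi xbar is in T.  Since (g o psi) x = g (psi x), the first one
    turns an error bound for g into one for g o psi.  The second one does the
    converse, once each y near psi xbar is written as psi x with x near xbar,
    which is metric regularity again.

    Metric regularity rests on three facts.
    - By Baire's theorem, a surjective linear map A onto a Banach space has an
      approximate right inverse of linear growth: every y has some v with
      |v| <= c |y| and |y - A v| <= |y| / 4 (surjective_almost_open).
    - By a mean value inequality, psi is strictly differentiable:
      psi - 'd psi xbar is Lipschitz near xbar with an arbitrarily small
      constant (C1_strictly_differentiable).
    - With such a right inverse sigma, the iteration
      x_(n+1) = x_n + sigma (y - psi x_n) halves the residual at each stage
      and converges to a solution close to its starting point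
      (graves_solution). *)

(** * Surjective linear maps onto Banach spaces *)

Lemma Baire_cover (R : realType) (Y : completeNormedModType R)
    (F : (set Y)^nat) :
  (forall n, closed (F n)) -> \bigcup_n F n = setT ->
  exists n y r, 0 < r /\ ball y r `<=` F n.
Proof.
move=> Fcl Fcover; apply: contrapT => noball.
have dense_compl n : open (~` F n) /\ dense (~` F n).
  split; first exact/closed_openC/Fcl.
  apply: contrapT => /denseNE[U [[y /open_nbhs_nbhs/nbhs_ballP[r r0 yrU]]]].
  move=> /(@subsetI_eq0 _ (ball y r) _ _ _ yrU (@subset_refl _ _)) yrF.
  apply: noball; exists n, y, r; split=> //.
  by move/disjoints_subset: yrF; rewrite setCK.
have := Baire dense_compl; rewrite -setC_bigcup Fcover setCT.
move=> /(_ setT); case=> [||y [_ []]]; last exact: openT.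
by exists 0.
Qed.

(** The first half of the open mapping theorem.  Exact preimages are not sought
    here, since the nonlinear iteration below absorbs the relative error 1/4
    together with its own. *)
Lemma surjective_almost_open (R : realType) (X : normedModType R)
    (Y : completeNormedModType R) (A : {linear X -> Y}) :
  range A = [set: Y] ->
  exists2 c : R, 0 < c & forall y, exists v,
    `|v| <= c * `|y| /\ `|y - A v| <= 4^-1 * `|y|.
Proof.
move=> surjA; pose F n := closure (A @` ball (0 : X) n.+1%:R).
have Fcover : \bigcup_n F n = setT.
  apply/seteqP; split=> // y _; have [v _ <-] : range A y by rewrite surjA.
  exists (Num.truncn `|v|) => //; apply: subset_closure; exists v => //.
  by rewrite -ball_normE /ball_/= sub0r normrN truncnS_gt.
have [n [y0 [r [r0 y0rF]]]] :=
  Baire_cover (fun n => @closed_closure _ _) Fcover.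
(* y0 and y0 + y are both limits of images of vectors shorter than n + 1;
   subtracting these vectors moves the small ball from y0 to the origin. *)
have approx y : `|y| < r ->
    exists v, `|v| <= 2 * n.+1%:R /\ `|y - A v| <= r / 8.
  move=> yr; have e0 : 0 < r / 16 by rewrite divr_gt0.
  have approx0 z : ball y0 r z ->
      exists2 v, `|v| <= n.+1%:R & `|z - A v| <= r / 16.
    move=> /y0rF /(_ _ (nbhsx_ballx z _ e0)) [_ [[v vn <-] zv]].
    move: vn zv; rewrite -!ball_normE /ball_/= sub0r normrN => vn zv.
    by exists v; exact: ltW.
  have [|v1 v1n y1] := approx0 (y0 + y).
    by rewrite -ball_normE /ball_/= opprD addrA subrr sub0r normrN.
  have [v2 v2n y2] := approx0 _ (ballxx y0 r0).
  exists (v1 - v2); split.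
    by rewrite (le_trans (ler_normB _ _))// mulr_natl mulr2n lerD.
  rewrite linearB/= (_ : y - _ = (y0 + y - A v1) - (y0 - A v2)); last first.
    by rewrite !opprB [RHS]addrC -(addrA y0) addrA subrK addrCA.
  rewrite (le_trans (ler_normB _ _))//; lra.
exists (4 * n.+1%:R / r) => [|y]; first by rewrite divr_gt0// mulr_gt0.
have [->|y_neq0] := eqVneq y 0.
  by exists 0; rewrite linear0 subr0 !normr0 !mulr0.
have ny0 : 0 < `|y| by rewrite normr_gt0.
(* k *: y has norm r / 2, for which the error r / 8 has relative size 1/4. *)
pose k := r / (2 * `|y|).
have k0 : 0 < k by rewrite divr_gt0// mulr_gt0.
have ky : k * `|y| = r / 2 by rewrite /k; field; exact: lt0r_neq0.
have [|v [vn yv]] := approx (k *: y).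
  by rewrite normrZ gtr0_norm// ky; lra.
exists (k^-1 *: v); split.
  rewrite normrZ gtr0_norm ?invr_gt0// ler_pdivrMl//.
  rewrite (_ : k * _ = 4 * n.+1%:R / r * (k * `|y|)); last by ring.
  rewrite ky (le_trans vn)// le_eqVlt; apply/orP; left; apply/eqP; field.
  exact: lt0r_neq0.
rewrite linearZ/= -[y in X in X <= _](scalerK (lt0r_neq0 k0)) -scalerBr normrZ.
rewrite gtr0_norm ?invr_gt0// ler_pdivrMl// (le_trans yv)//.
by rewrite mulrCA ky; lra.
Qed.

(** * Strict differentiability of C^1 maps *)

(** With values in a normed space, the increment of phi over [0, 1] need not be
    a derivative at an intermediate point, so the real mean value theorem is
    replaced by a continuity argument.  The supremum c of the times t at which
    |phi t - phi 0| <= K t is itself such a time, by the local bound to the left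
    of c, and cannot be smaller than 1, by the local bound to the right of c. *)
Lemma mean_value_inequality (R : realType) (W : normedModType R) (phi : R -> W)
    (K : R) :
  (forall t : R, 0 <= t <= 1 ->
     \forall s \near t, `|phi s - phi t| <= K * `|s - t|) ->
  `|phi 1 - phi 0| <= K.
Proof.
move=> loc; pose S := [set t : R | 0 <= t <= 1 /\ `|phi t - phi 0| <= K * t].
have S0 : S 0 by split; rewrite ?lexx ?ler01// subrr normr0 mulr0.
have hsS : has_sup S by split; [exists 0 | exists 1 => t [/andP[]]].
pose c := sup S.
have c01 : 0 <= c <= 1.
  apply/andP; split; first by apply: ub_le_sup => //; case: hsS.
  by apply: ge_sup; [exists 0 | move=> t [/andP[]]].
have /nbhs_ballP[d /= d0 locd] := loc _ c01.
have Sc : S c.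
  split=> //; have [s Ss cs] := sup_adherent d0 hsS.
  have sc : s <= c by apply: ub_le_sup => //; case: hsS.
  have := locd s; rewrite -ball_normE /ball_/= ger0_norm ?subr_ge0//.
  move=> /(_ ltac:(by rewrite /c in sc *; lra)).
  rewrite [`|s - c|]distrC ger0_norm ?subr_ge0// => cs'; case: Ss => _ s0.
  rewrite (_ : _ - _ = (phi s - phi 0) - (phi s - phi c)); last first.
    by rewrite opprB [RHS]addrC addrA subrK.
  by rewrite (le_trans (ler_normB _ _))//; lra.
suff c1 : c = 1 by case: Sc => _; rewrite c1 mulr1.
apply/eqP; rewrite eq_le; case/andP: (c01) => c0 -> /=.
rewrite leNgt; apply/negP => c1.
pose s := Num.min 1 (c + d / 2).
have cs : c < s by rewrite lt_min c1/=; lra.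
suff : S s by move=> /(ub_le_sup (proj2 hsS)); rewrite -/c leNgt cs.
have s1 : s <= 1 by rewrite ge_min lexx.
have sd : s <= c + d / 2 by rewrite ge_min lexx orbT.
split; first by lra.
have := locd s; rewrite -ball_normE /ball_/= distrC ger0_norm; last by lra.
move=> /(_ ltac:(lra)) h; case: Sc => _ h0.
rewrite -(subrKA (phi c)) (le_trans (ler_normD _ _))//; lra.
Qed.

Lemma differentiable_near_le (R : realType) (X Y : normedModType R)
    (f : X -> Y) (x : X) (e : R) :
  differentiable f x -> 0 < e ->
  \forall z \near x, `|f z - f x - 'd f x (z - x)| <= e * `|z - x|.
Proof.
move=> /diff_locally /eqaddoP /[apply]; rewrite (near_shift 0 x) /=.
apply: filterS => z; rewrite /= subr0.
rewrite addrK -[X in `|X| <= _ -> _]/(f (z + x) - (f x + 'd f x z)).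
by rewrite opprD addrA.
Qed.

Lemma op_norm_le (R : realType) (X Y : normedModType R) (L : {linear X -> Y})
    (e : R) : (op_norm L <= e%:E)%E -> forall v, `|L v| <= e * `|v|.
Proof.
move=> Le v; have [->|v0] := eqVneq v 0; first by rewrite linear0 !normr0 mulr0.
have nv : 0 < `|v| by rewrite normr_gt0.
have : (`|L (`|v|^-1 *: v)|%:E <= e%:E)%E.
  apply: le_trans Le; apply: ereal_sup_ubound; exists (`|v|^-1 *: v) => //=.
  by rewrite normrZ gtr0_norm ?invr_gt0// mulVf ?gt_eqF.
by rewrite lee_fin linearZ/= normrZ gtr0_norm ?invr_gt0// ler_pdivrMl// mulrC.
Qed.

(** Along the segment from v to u, subtracting the linear part
    t 'd psi x (u - v) leaves a curve with a small local Lipschitz constant: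
    half of e pays for the oscillation of 'd psi on the ball, half for the error
    of the first-order expansion of psi at the current point. *)
Lemma C1_strictly_differentiable (R : realType) (X Y : normedModType R)
    (psi : X -> Y) (x : X) (e : R) :
  continuously_differentiable psi -> 0 < e ->
  exists2 r, 0 < r & forall u v, ball x r u -> ball x r v ->
    `|psi u - psi v - 'd psi x (u - v)| <= e * `|u - v|.
Proof.
move=> [dpsi cpsi] e0; have e20 : 0 < e / 2 by rewrite divr_gt0.
have : \forall z \near x,
   (op_norm (fun v => 'd psi z v - 'd psi x v)%R < (e / 2)%:E)%E.
  apply: (cpsi x [set a | (a < (e / 2)%:E)%E]); apply: open_nbhs_nbhs.
  by split; [exact: open_ereal_lt_ereal | rewrite /= lte_fin].
move=> /nbhs_ballP[r /= r0 opr]; exists r => // u v xu xv.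
have segment t : 0 <= t <= 1 -> ball x r (v + t *: (u - v)).
  move=> /andP[t0 t1]; move: xu xv; rewrite -!ball_normE /ball_/= => xu xv.
  have -> : x - (v + t *: (u - v)) = t *: (x - u) + (1 - t) *: (x - v).
    rewrite scalerBl scale1r addrCA -scalerBr.
    by rewrite opprB [x - u + _]addrC subrKA opprD -scalerN opprB addrA.
  have := ler_normD (t *: (x - u)) ((1 - t) *: (x - v)).
  rewrite !normrZ !ger0_norm ?subr_ge0// => /le_lt_trans; apply.
  have [->|tn0] := eqVneq t 0; first by rewrite mul0r add0r subr0 mul1r.
  have t_gt0 : 0 < t by rewrite lt_neqAle eq_sym tn0.
  rewrite (lt_le_trans (y := t * r + (1 - t) * `|x - v|)) ?ltrD2r ?ltr_pM2l//.
  rewrite [leRHS](_ : r = t * r + (1 - t) * r); last by ring.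
  by rewrite lerD2l ler_wpM2l ?subr_ge0// ltW.
pose phi (t : R) := psi (v + t *: (u - v)) - t *: 'd psi x (u - v).
have -> : psi u - psi v - 'd psi x (u - v) = phi 1 - phi 0.
  by rewrite /phi !scale0r addr0 !scale1r subr0 [v + _]addrC subrK addrAC.
apply: mean_value_inequality => t t01; set z := v + t *: (u - v).
have dz : forall w, `|'d psi z w - 'd psi x w| <= e / 2 * `|w|.
  apply: (@op_norm_le _ _ _ ('d psi z \- 'd psi x)); apply: ltW.
  exact: opr (segment t t01).
have line_cvg : v + s *: (u - v) @[s --> t] --> z.
  by apply: cvgD; [exact: cvg_cst | apply: cvgZr_tmp; exact: cvg_id].
have line_near : \forall s \near t, let zs := v + s *: (u - v) in
    `|psi zs - psi z - 'd psi z (zs - z)| <= e / 2 * `|zs - z|.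
  exact: line_cvg _ (differentiable_near_le (dpsi z) e20).
apply: filterS line_near => s /=.
have -> : v + s *: (u - v) - z = (s - t) *: (u - v).
  by rewrite /z opprD addrACA subrr add0r scalerBl.
rewrite normrZ => psis.
have -> : phi s - phi t = (psi (v + s *: (u - v)) - psi z
    - 'd psi z ((s - t) *: (u - v))) +
    ('d psi z ((s - t) *: (u - v)) - 'd psi x ((s - t) *: (u - v))).
  rewrite addrA subrK /phi -/z [in X in _ = _ - X]linearZ/= scalerBl.
  by rewrite !opprD !opprK addrACA.
rewrite (le_trans (ler_normD _ _))// (le_trans (lerD psis (dz _)))//.
by rewrite normrZ; lra.
Qed.

Lemma C1_locally_lipschitz (R : realType) (X Y : normedModType R)
    (psi : X -> Y) (x : X) :
  continuously_differentiable psi ->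
  exists L r, [/\ 0 < L, 0 < r & forall u v, ball x r u -> ball x r v ->
    `|psi u - psi v| <= L * `|u - v|].
Proof.
move=> C1; have cdpsi : continuous ('d psi x).
  by apply: diff_continuous; case: C1.
have /linear_boundedP/pinfty_ex_gt0[M M0 dpsiM] :=
  continuous_linear_bounded 0 (cdpsi 0).
have [r r0 strict] := C1_strictly_differentiable x C1 ltr01.
exists (1 + M), r; split=> [||u v xu xv] //; first by rewrite addr_gt0.
rewrite -[psi u - psi v](subrK ('d psi x (u - v))) mulrDl.
by rewrite (le_trans (ler_normD _ _))// lerD// strict.
Qed.

(** * Metric regularity *)

Lemma cvg_halves (R : realType) (a : R) : a * 2^-1 ^+ n @[n --> \oo] --> 0.
Proof. by apply: cvg_geometric; rewrite gtr0_norm; lra. Qed.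

Lemma cvg_geometric_steps (R : realType) (X : completeNormedModType R)
    (u : X^nat) (M : R) :
  (forall n, `|u n.+1 - u n| <= M * 2^-1 ^+ n) ->
  exists2 l, u @ \oo --> l & forall n, `|u n - l| <= 2 * M * 2^-1 ^+ n.
Proof.
move=> uM; have M0 : 0 <= M.
  by have := uM 0%N; rewrite expr0 mulr1; apply: le_trans.
have dist n m : `|u n - u (n + m)%N| <= 2 * M * (2^-1 ^+ n - 2^-1 ^+ (n + m)).
  elim: m => [|m IHm]; first by rewrite addn0 !subrr normr0 mulr0.
  rewrite addnS -(subrKA (u (n + m)%N)) (le_trans (ler_normD _ _))//.
  have := uM (n + m)%N; rewrite distrC => step.
  by rewrite (le_trans (lerD IHm step))// exprS; lra.
have half0 k : 0 < 2^-1 ^+ k :> R by rewrite exprn_gt0.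
have near_tail n : \forall m \near \oo, `|u n - u m| <= 2 * M * 2^-1 ^+ n.
  exists n => // m /= /subnKC <-; apply: le_trans (dist n _) _.
  by rewrite ler_wpM2l ?mulr_ge0// gerBl ltW.
have : cvg (u @ \oo).
  apply: cauchy_cvg; apply: cauchy_exP => e e0.
  have /cvgrPdist_lt/(_ _ e0)[N _ /(_ N (leqnn _))] /= := cvg_halves (2 * M).
  rewrite sub0r normrN ger0_norm; last by rewrite !mulr_ge0// ltW.
  move=> Ne; exists (u N); apply: filterS (near_tail N) => m.
  by rewrite -ball_normE /=; move/le_lt_trans; apply.
move=> /cvg_ex[l ul]; exists l => // n.
have ulm : `|u n - u m| @[m --> \oo] --> `|u n - l|.
  by apply: cvg_norm; apply: cvgB => //; exact: cvg_cst.
apply: (closed_cvg (fun r : R => r <= _) _ (near_tail n) _ ulm).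
exact: closed_le.
Qed.

(** The usual d(u, psi^-1 y) <= kappa d(y, psi u), with the infimum on the left
    replaced by an actual solution. *)
Definition metrically_regular (R : realType) (X Y : normedModType R)
    (psi : X -> Y) (x : X) : Prop :=
  exists kappa r, [/\ 0 < kappa, 0 < r & forall u y,
    ball x r u -> ball (psi x) r y ->
    exists2 v, psi v = y & `|u - v| <= kappa * `|y - psi u|].

(** Correcting x_n by an approximate solution s of A s = y - psi x_n leaves the
    residual (y - psi x_n - A s) - (psi x_(n+1) - psi x_n - A s).  The first
    part is a quarter of the old residual by the choice of s; so is the second,
    because |s| is at most c times the old residual and psi - A has Lipschitz
    constant 1 / (4 c).  Hence residuals are halved, the steps are dominated by
    a geometric series of sum 2 c |y - psi u|, and the bound imposed on that sum
    keeps the iterates in the ball where psi - A is controlled. *)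
Lemma graves_solution (R : realType) (X : completeNormedModType R)
    (Y : normedModType R) (psi : X -> Y) (xbar : X) (A : X -> Y) (c r : R) :
  continuous psi -> 0 < c -> 0 < r ->
  (forall y, exists v, `|v| <= c * `|y| /\ `|y - A v| <= 4^-1 * `|y|) ->
  (forall u v, ball xbar r u -> ball xbar r v ->
    `|psi u - psi v - A (u - v)| <= (4 * c)^-1 * `|u - v|) ->
  forall u y, ball xbar (r / 2) u -> 2 * c * `|y - psi u| < r / 2 ->
  exists2 v, psi v = y & `|u - v| <= 2 * c * `|y - psi u|.
Proof.
move=> cpsi c0 r0 /choice[sigma /all_and2[sigma_le sigma_inv]] strict u y xu.
set d := `|y - psi u| => ud.
pose x := fix x n := if n is n'.+1 then x n' + sigma (y - psi (x n')) else u.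
have half0 k : 0 < 2^-1 ^+ k :> R by rewrite exprn_gt0.
have d0 : 0 <= d by exact: normr_ge0.
have inv n : `|u - x n| <= 2 * c * d * (1 - 2^-1 ^+ n) /\
    `|y - psi (x n)| <= d * 2^-1 ^+ n.
  elim: n => [|n [IHx IHy]].
    by rewrite /= expr0 !subrr normr0 mulr0 mulr1.
  have step : `|sigma (y - psi (x n))| <= c * (d * 2^-1 ^+ n).
    by rewrite (le_trans (sigma_le _))// ler_pM2l.
  have x_le : `|u - x n.+1| <= 2 * c * d * (1 - 2^-1 ^+ n.+1).
    rewrite /= opprD addrA (le_trans (ler_normB _ _))//.
    by rewrite (le_trans (lerD IHx step))// exprS; lra.
  split=> //.
  have in_ball k : `|u - x k| <= 2 * c * d * (1 - 2^-1 ^+ k) ->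
      ball xbar r (x k).
    move: xu; rewrite -!ball_normE /ball_/= => xu uxk.
    rewrite -(subrKA u) (le_lt_trans (ler_normD _ _))//.
    suff : `|u - x k| < r / 2 by lra.
    rewrite (le_lt_trans uxk)// (le_lt_trans _ ud)//.
    by rewrite ler_piMr// !mulr_ge0// ltW.
  have := strict _ _ (in_ball _ x_le) (in_ball _ IHx).
  have -> : x n.+1 - x n = sigma (y - psi (x n)).
    by rewrite /= addrAC subrr add0r.
  set s := sigma _ => strict_n.
  have -> : y - psi (x n.+1) =
      (y - psi (x n) - A s) - (psi (x n.+1) - psi (x n) - A s).
    by rewrite [X in _ = _ + X]opprB subrKA opprB subrKA.
  rewrite (le_trans (ler_normB _ _))//.
  rewrite (le_trans (lerD (sigma_inv _) strict_n))//.
  have : (4 * c)^-1 * `|s| <= 4^-1 * (d * 2^-1 ^+ n).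
    by rewrite invfM -mulrA ler_pM2l ?invr_gt0// ler_pdivrMl.
  by rewrite exprS; lra.
have [|v xv uv] := @cvg_geometric_steps _ _ x (c * d).
  move=> n; rewrite /= addrAC subrr add0r (le_trans (sigma_le _))//.
  by rewrite -mulrA ler_pM2l//; case: (inv n).
exists v; last by have := uv 0%N; rewrite expr0 mulr1 mulrA.
have psixv : psi (x n) @[n --> \oo] --> psi v.
  by apply: continuous_cvg => //; exact: cpsi.
have psixy : psi (x n) @[n --> \oo] --> y.
  apply/cvgrPdist_le => e e0.
  have /cvgrPdist_le/(_ _ e0) := cvg_halves d; apply: filterS => n /=.
  rewrite sub0r normrN ger0_norm; last by rewrite mulr_ge0// ltW.
  by apply: le_trans; case: (inv n).
exact: cvg_unique psixv psixy.
Qed.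

(** The radius makes |y - psi u| less than r / (4 c): half of it for the
    distance from y to psi xbar, half for that from psi xbar to psi u. *)
Lemma lyusternik_graves (R : realType) (X Y : completeNormedModType R)
    (psi : X -> Y) (xbar : X) :
  continuously_differentiable psi -> range ('d psi xbar) = [set: Y] ->
  metrically_regular psi xbar.
Proof.
move=> C1 /surjective_almost_open[c c0 approx_inv].
have cpsi : continuous psi.
  by move=> x; apply: differentiable_continuous; case: C1.
have [|r r0 strict] := @C1_strictly_differentiable _ _ _ _ xbar (4 * c)^-1 C1.
  by rewrite invr_gt0 mulr_gt0.
have s0 : 0 < r / (8 * c) by rewrite divr_gt0// mulr_gt0.
have /cvgrPdist_lt/(_ _ s0)/nbhs_ballP[d /= d0 psid] := cpsi xbar.
exists (2 * c), (Num.min (r / 2) (Num.min d (r / (8 * c)))).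
split=> [||u y]; rewrite ?mulr_gt0 ?lt_min ?d0 ?s0 ?divr_gt0//.
rewrite -ball_normE /ball_/= !lt_min => /and3P[ur ud _].
rewrite -ball_normE /ball_/= !lt_min => /and3P[_ _ yc].
apply: (graves_solution cpsi c0 r0 approx_inv strict).
  by rewrite -ball_normE.
have uc : `|psi xbar - psi u| < r / (8 * c) by apply: psid; rewrite -ball_normE.
have -> : r / 2 = 2 * c * (r / (8 * c) + r / (8 * c)).
  by field; exact: lt0r_neq0.
rewrite ltr_pM2l ?mulr_gt0// -(subrKA (psi xbar)).
by rewrite (le_lt_trans (ler_normD _ _))// ltrD// distrC.
Qed.

(** * Transfer of distances and of error bounds *)

Lemma distance_le (R : realType) (X : normedModType R) (x u : X) (S : set X) :
  S u -> (distance x S <= `|x - u|%:E)%E.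
Proof. by move=> Su; apply: ereal_inf_lbound; exists u. Qed.

(** Points of S farther than rho from x do not affect the distance from x to S,
    so it suffices to compare the points of S near x with points of T. *)
Lemma distance_le_transfer (R : realType) (X Y : normedModType R)
    (x : X) (y : Y) (S : set X) (T : set Y) (k rho : R) :
  0 < k -> (distance x S < rho%:E)%E ->
  (forall u, S u -> `|x - u| < rho ->
    exists2 v, T v & `|y - v| <= k * `|x - u|) ->
  (distance y T <= k%:E * distance x S)%E.
Proof.
move=> k0 /ereal_inf_lt[_ [u0 Su0 <-]]; rewrite lte_fin => u0rho transfer.
have near_le u : S u -> `|x - u| < rho ->
    (k^-1%:E * distance y T <= `|x - u|%:E)%E.
  move=> Su /(transfer _ Su)[v Tv yv]; rewrite lee_pdivrMl// -EFinM.
  by apply: le_trans (distance_le _ Tv) _; rewrite lee_fin.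
rewrite -lee_pdivrMl//; apply: le_ereal_inf_tmp => _ [u Su <-].
have [/near_le|rho_le] := ltP `|x - u| rho; first exact.
apply: le_trans (near_le _ Su0 u0rho) _.
by rewrite lee_fin (le_trans (ltW u0rho)).
Qed.

(** Metric regularity lifts the points of solution_set g near psi x to solutions
    of g o psi near x. *)
Lemma local_error_bound_precomp (R : realType) (X Y : normedModType R)
    (psi : X -> Y) (g : Y -> \bar R) (xbar : X) :
  {for xbar, continuous psi} -> metrically_regular psi xbar ->
  solution_set g (psi xbar) ->
  local_error_bound g (psi xbar) -> local_error_bound (g \o psi) xbar.
Proof.
move=> cpsi [k [r [k0 r0 reg]]] gxbar [tau [delta [tau0 delta0 bound]]].
have e0 : 0 < Num.min delta (r / 2) by rewrite lt_min delta0 divr_gt0.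
have /cvgrPdist_lt/(_ _ e0)/nbhs_ballP[d /= d0 psid] := cpsi.
exists (k * tau), (Num.min d r); split; rewrite ?mulr_gt0 ?lt_min ?d0// => x.
rewrite -ball_normE /ball_/= lt_min => /andP[xd xr].
have := psid x; rewrite -ball_normE /ball_/= lt_min => /(_ xd)/andP[psix psixr].
rewrite EFinM -muleA.
apply: (@le_trans _ _ (k%:E * distance (psi x) (solution_set g))%E); last first.
  by rewrite lee_pmul2l// bound// -ball_normE.
apply: (@distance_le_transfer _ _ _ _ _ _ _ _ (r / 2)) => // [|u gu psixu].
  by apply: le_lt_trans (distance_le _ gxbar) _; rewrite lte_fin distrC.
have [||v psiv xv] := reg x u; rewrite -?ball_normE//=.
  by rewrite -(subrKA (psi x)) (le_lt_trans (ler_normD _ _))//; lra.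
by exists v; [rewrite /solution_set/= psiv | rewrite [`|_ - u|]distrC].
Qed.

(** Metric regularity writes each y near psi xbar as psi x with x near xbar; the
    error bound at x is then pushed forward by the Lipschitz map psi. *)
Lemma local_error_bound_of_precomp (R : realType) (X Y : normedModType R)
    (psi : X -> Y) (g : Y -> \bar R) (xbar : X) (L r : R) :
  0 < L -> 0 < r ->
  (forall u v, ball xbar r u -> ball xbar r v ->
    `|psi u - psi v| <= L * `|u - v|) ->
  metrically_regular psi xbar -> solution_set g (psi xbar) ->
  local_error_bound (g \o psi) xbar -> local_error_bound g (psi xbar).
Proof.
move=> L0 r0 lip [k [s [k0 s0 reg]]] gxbar [tau [delta [tau0 delta0 bound]]].
exists (L * tau), (Num.min s (Num.min delta (r / 2) / k)).
split; rewrite ?mulr_gt0 ?lt_min ?s0 ?divr_gt0 ?lt_min ?delta0 ?divr_gt0// => y.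
rewrite -ball_normE /ball_/= lt_min ltr_pdivlMr// mulrC distrC => /andP[ys yk].
have [||x psix xbarx] := reg xbar y;
  rewrite -?ball_normE//= ?subrr ?normr0 1?distrC//.
have /andP[xdelta xr] : (`|xbar - x| < delta) && (`|xbar - x| < r / 2).
  by rewrite -lt_min (le_lt_trans xbarx).
rewrite EFinM -muleA -psix.
pose S := solution_set (g \o psi).
apply: (@le_trans _ _ (L%:E * distance x S)%E); last first.
  by rewrite lee_pmul2l// bound// -ball_normE.
apply: (@distance_le_transfer _ _ _ _ _ _ _ _ (r / 2)) => // [|u gu xu].
  apply: le_lt_trans (distance_le (u := xbar) _ gxbar) _.
  by rewrite lte_fin distrC.
exists (psi u) => //; apply: lip; rewrite -ball_normE/=; first by lra.
by rewrite -(subrKA x) (le_lt_trans (ler_normD _ _))//; lra.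
Qed.

Theorem theorem3p5 (R : realType) (X Y : completeNormedModType R)
    (asplX : asplund X) (asplY : asplund Y)
    (psi : X -> Y) (psiC1 : continuously_differentiable psi)
    (g : Y -> \bar R) (g_proper : proper_fun g)
    (g_lsc : lower_semicontinuous g) (g_convex : ereal_convex g)
    (bdSg : boundary (solution_set g) `<=` g @^-1` [set 0%E])
    (xbar : X) (xbarS : solution_set (g \o psi) xbar)
    (dpsi_surj : range ('d psi xbar) = [set: Y]) :
  local_error_bound (g \o psi) xbar <-> local_error_bound g (psi xbar).
Proof.
have reg := lyusternik_graves psiC1 dpsi_surj.
have [L [r [L0 r0 lip]]] := C1_locally_lipschitz xbar psiC1.
split; first exact: local_error_bound_of_precomp L0 r0 lip reg xbarS.
apply: local_error_bound_precomp => //.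
by apply: differentiable_continuous; case: psiC1.
Qed.
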